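(* Let $0<q<1$, $p=q^{1/2}$, $\alpha,\beta>-1$ real. Then $$\lim_{n\to\infty}x^n\,b_n^{(\alpha,\beta)}(1/x)=\Phi_{\alpha,\beta}(x),$$ uniformly on compact subsets of the complex $x$-plane (for $x=0$ the left side is interpreted as the value at $0$ of the polynomial $x^nb_n^{(\alpha,\beta)}(1/x)$).
   Context: Notation: $(a;p)_0=1$, $(a;p)_n=\prod_{j=0}^{n-1}(1-ap^j)$, $(a;p)_\infty=\prod_{j\ge0}(1-ap^j)$, $(a_1,\dots,a_m;p)_n=\prod_k(a_k;p)_n$; ${}_2\phi_1(a,b;c;p,z)=\sum_{k\ge0}\frac{(a,b;p)_k}{(p,c;p)_k}z^k$. The polynomials $b_n=b_n^{(\alpha,\beta)}$ are defined by $b_{-1}(\mu)=0$, $b_0(\mu)=1$, and for $k\ge0$ $$b_{k+1}(\mu)=\Big[\mu+\frac{(1-p^{\beta-\alpha})(1+p^{\alpha+\beta+3+2k})}{(1-p^{\alpha+\beta+2+2k})(1-p^{\alpha+\beta+4+2k})}p^{\alpha+3/2+k}\Big]b_k(\mu)+\frac{(1-p^{2\alpha+2+2k})(1-p^{2\beta+2+2k})\,p^{2k+\alpha+\beta+2}}{(1-p^{\alpha+\beta+1+2k})(1-p^{\alpha+\beta+2+2k})^2(1-p^{\alpha+\beta+3+2k})}\,b_{k-1}(\mu).$$ The entire function $\Phi_{\alpha,\beta}$ is $$\Phi_{\alpha,\beta}(y)=\frac{(p^{\beta+1};p)_\infty}{(p^{\alpha+\beta+2};p)_\infty}\sum_{k\ge0}\frac{(p^{\alpha+1},p^{1/2}y;p)_k}{(p;p)_k}\,p^{(\beta+1)k}\,(-p^{\alpha+3/2+k}y;p)_\infty,$$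 which equals $\frac{(p^{\beta+1},-p^{\alpha+3/2}y;p)_\infty}{(p^{\alpha+\beta+2};p)_\infty}{}_2\phi_1(p^{\alpha+1},p^{1/2}y;-p^{\alpha+3/2}y;p,p^{\beta+1})$ wherever the latter is defined. *)

(* Defs.v *)
From HB Require Import structures.
From mathcomp Require Import all_boot all_order all_algebra.
From mathcomp Require Import all_classical all_reals all_analysis.
From mathcomp Require Import complex.
Set Implicit Arguments. Unset Strict Implicit. Unset Printing Implicit Defensive.
Import Order.TTheory GRing.Theory Num.Theory.
Import numFieldNormedType.Exports.
Local Open Scope ring_scope.
Local Open Scope complex_scope.

(* Endow R[i] (a numClosedFieldType) with its canonical normed-space topology
   (the one induced by its norm), as mathcomp-analysis does for any numFieldType. *)
HB.instance Definition _ (R : rcfType) := PseudoPointedMetric.copy R[i] R[i]^o.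
HB.instance Definition _ (R : rcfType) := NormedModule.copy R[i] R[i]^o.

Definition cpw (R : realType) (p a : R) : R[i] := (p `^ a)%:C.

(* coefficient of b_k in the recurrence for b_{k+1} (without mu) *)
Definition bA (R : realType) (p al be : R) (k : nat) : R :=
  (1 - p `^ (be - al)) * (1 + p `^ (al + be + 3 + 2 * k%:R))
  / ((1 - p `^ (al + be + 2 + 2 * k%:R)) * (1 - p `^ (al + be + 4 + 2 * k%:R)))
  * p `^ (al + 3 / 2 + k%:R).

(* coefficient of b_{k-1} in the recurrence for b_{k+1} *)
Definition bB (R : realType) (p al be : R) (k : nat) : R :=
  (1 - p `^ (2 * al + 2 + 2 * k%:R)) * (1 - p `^ (2 * be + 2 + 2 * k%:R))
  * p `^ (2 * k%:R + al + be + 2)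
  / ((1 - p `^ (al + be + 1 + 2 * k%:R)) * (1 - p `^ (al + be + 2 + 2 * k%:R)) ^+ 2
     * (1 - p `^ (al + be + 3 + 2 * k%:R))).

(* bpair n = (b_{n-1}, b_n) as complex polynomials in mu, with b_{-1} = 0, b_0 = 1 *)
Fixpoint bpair (R : realType) (p al be : R) (n : nat) : {poly R[i]} * {poly R[i]} :=
  match n with
  | 0 => (0, 1)
  | k.+1 =>
      let bb := bpair p al be k in
      (bb.2, ('X + ((bA p al be k)%:C)%:P) * bb.2 + ((bB p al be k)%:C)%:P * bb.1)
  end.

Definition bpoly (R : realType) (p al be : R) (n : nat) : {poly R[i]} :=
  (bpair p al be n).2.

(* the value at x of the polynomial x^n b_n(1/x) (reversed coefficients) *)
Definition bres (R : realType) (p al be : R) (n : nat) (x : R[i]) : R[i] :=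
  \sum_(i < n.+1) (bpoly p al be n)`_i * x ^+ (n - i).

Definition qpoch (R : realType) (a : R[i]) (p : R) (n : nat) : R[i] :=
  \prod_(j < n) (1 - a * (p ^+ j)%:C).

Definition qpoch_inf (R : realType) (a : R[i]) (p : R) : R[i] :=
  limn (fun n => qpoch a p n).

Definition Phi_term (R : realType) (p al be : R) (y : R[i]) (k : nat) : R[i] :=
  qpoch (cpw p (al + 1)) p k * qpoch (cpw p (1 / 2) * y) p k / qpoch (p%:C) p k
  * cpw p ((be + 1) * k%:R)
  * qpoch_inf (- (cpw p (al + 3 / 2 + k%:R) * y)) p.

Definition Phi (R : realType) (p al be : R) (y : R[i]) : R[i] :=
  qpoch_inf (cpw p (be + 1)) p / qpoch_inf (cpw p (al + be + 2)) p
  * limn (series (Phi_term p al be y)).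

(* Main.v *)
Require Import Defs.
From HB Require Import structures.
From mathcomp Require Import all_boot all_order all_algebra.
From mathcomp Require Import all_classical all_reals all_analysis.
From mathcomp Require Import complex ring lra.
Import Order.TTheory GRing.Theory Num.Theory.
Import numFieldNormedType.Exports.
Import ComplexField.Normc.
Local Open Scope ring_scope.
Local Open Scope classical_set_scope.
Local Open Scope complex_scope.

(* Replacing (al, be) by (al + 1, be + 1) shifts the index of the recurrence
   coefficients A_k, B_k of b_n by one. The proof rests on the contiguous relation
     Phi_{al,be} = (1 + A_0 x) Phi_{al+1,be+1} + B_1 x^2 Phi_{al+2,be+2},
   which holds term by term up to a telescoping series with an explicit
   certificate. Iterating it, r_n := x^n b_n(1/x) and F_n := Phi_{al+n,be+n}(x) satisfy
     F_0 = r_{n+1} F_{n+1} + B_{n+1} x^2 r_n F_{n+2}.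
   For bounded x the r_n stay bounded since A_n and B_n decay like p^n, and F_n - 1
   is O(p^n); hence r_n converges to F_0 at a uniform geometric rate. *)

(** No closed form of b_n is used, and no limit is taken inside a sum. The expansion of F_0 is an
    exact identity, so the only analysis left is that F_n tends to 1 and r_n stays bounded; together
    these identify the limit. In the variables a = p^(al+1), z = p^(be+1), s = p^(1/2) x, raising
    both parameters by one multiplies a and z by p and fixes s. Hence both are of order p^n after n
    steps: only the term k = 0 of the series survives, and all infinite products tend to 1. The
    quotient of products in front of the series is what turns the polynomial coefficients of the
    relation between the bare series into A_0 and B_1. Keeping the product (- a s p^k; p)_oo inside
    the sum avoids the poles of the 2phi1 form, so x ranges over the whole plane. All estimates are
    made with the real-valued modulus [normc], because the norm of [R[i]] takes its values in
    [R[i]]. *)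

Lemma normcD_le {R : realType} (x y : R[i]) : normc (x + y) <= normc x + normc y.
Proof. exact: le_normcD. Qed.

Lemma normc_opp {R : realType} (x : R[i]) : normc (- x) = normc x.
Proof. exact: normcN. Qed.

Lemma normcB_le {R : realType} (x y : R[i]) : normc (x - y) <= normc x + normc y.
Proof. by rewrite -(normc_opp y); apply: normcD_le. Qed.

Lemma normc_ge0 {R : realType} (x : R[i]) : 0 <= normc x.
Proof. by rewrite -lecR; apply: (normr_ge0 x). Qed.

Lemma normcR {R : realType} (x : R) : normc x%:C = `|x|.
Proof. by rewrite /normc /= expr0n addr0 sqrtr_sqr. Qed.

Lemma normcX {R : realType} (x : R[i]) n : normc (x ^+ n) = normc x ^+ n.
Proof. by elim: n => [|n IH]; rewrite ?expr0 ?normc1 // !exprS normcM IH. Qed.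

Lemma normc_Re {R : realType} (x : R[i]) : `|complex.Re x| <= normc x.
Proof. by rewrite -lecR; apply: normc_ge_Re. Qed.

Lemma normc_Im {R : realType} (x : R[i]) : `|complex.Im x| <= normc x.
Proof.
case: x => a b; rewrite /normc /= -[leLHS]sqrtr_sqr.
by rewrite ler_wsqrtr // lerDr sqr_ge0.
Qed.

Lemma normc_le_ReIm {R : realType} (x : R[i]) : normc x <= `|complex.Re x| + `|complex.Im x|.
Proof.
rewrite {1}[x]complexE; apply: (le_trans (normcD_le _ _)).
rewrite normcM !normcR lerD2l ler_piMl //.
by rewrite /normc /= expr0n add0r expr1n sqrtr1.
Qed.

(** * Convergence of complex sequences and boundedness of compact sets *)

Lemma ReB {R : realType} (x y : R[i]) : complex.Re (x - y) = complex.Re x - complex.Re y.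
Proof. by case: x; case: y. Qed.

Lemma ImB {R : realType} (x y : R[i]) : complex.Im (x - y) = complex.Im x - complex.Im y.
Proof. by case: x; case: y. Qed.

(** The radii of balls in [R[i]] are themselves complex, but a positive complex number has zero
    imaginary part, so real radii suffice. *)
Lemma cvgcP {R : realType} (u : nat -> R[i]) (l : R[i]) :
  (u @ \oo --> l) <->
  (forall e : R, 0 < e -> \forall n \near \oo, normc (u n - l) < e).
Proof.
split=> [/cvgrPdistC_lt h e e0|h].
  have := h e%:C; rewrite ltcR => /(_ e0).
  by apply: filterS => n; rewrite -ltcR.
apply/cvgrPdistC_lt => -[e i]; rewrite ltcE /= => /andP[/eqP -> re].
by have := h _ re; apply: filterS => n; rewrite -ltcR.
Qed.

Lemma limnc_eq {R : realType} (u : nat -> R[i]) (l : R[i]) :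
  u @ \oo --> l -> limn u = l.
Proof. by move=> h; apply: cvg_lim. Qed.

Lemma cvgc_uniq {R : realType} {u : nat -> R[i]} {l l' : R[i]} :
  u @ \oo --> l -> u @ \oo --> l' -> l = l'.
Proof. by move=> /limnc_eq <- /limnc_eq. Qed.

Lemma normc_cvg_le {R : realType} (u : nat -> R[i]) (l : R[i]) (c : R) :
  u @ \oo --> l -> (\forall n \near \oo, normc (u n) <= c) -> normc l <= c.
Proof.
move=> /cvgcP ul uc; apply/ler_addgt0Pr => e e0.
have [n [h1 h2]] : exists n, normc (u n) <= c /\ normc (u n - l) < e.
  by near (\oo : set_system nat) => n; exists n; split; near: n => //; exact: ul.
have -> : l = u n - (u n - l) by ring.
by apply: (le_trans (normcB_le _ _)); lra.
Unshelve. all: by end_near.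
Qed.

Lemma is_cvg_geometric_steps {R : realType} (v : nat -> R) (C r : R) :
  0 <= r -> r < 1 -> (forall n, `|v n.+1 - v n| <= C * r ^+ n) -> cvgn v.
Proof.
move=> r0 r1 h.
have cs : cvgn (series (telescope v)).
  apply: normed_cvg; apply: (@series_le_cvg _ _ (geometric C r)) => [n|n|n|].
  - exact: normr_ge0.
  - by apply: le_trans (h n).
  - exact: h.
  - by apply: is_cvg_geometric_series; rewrite ger0_norm.
have -> : v = cst (v 0%N) \+ series (telescope v).
  by apply/funext => n; rewrite /= -eq_sum_telescope.
by apply: is_cvgD => //; apply: is_cvg_cst.
Qed.

(** Completeness is used for real and imaginary parts separately, while the error bound is obtained
    for the modulus directly. It serves both the infinite products and the series of Phi. *)
Lemma cvgc_geometric_steps {R : realType} (u : nat -> R[i]) (C r : R) :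
  0 <= r -> r < 1 -> (forall n, normc (u n.+1 - u n) <= C * r ^+ n) ->
  exists2 l : R[i], u @ \oo --> l & forall n, normc (l - u n) <= C * r ^+ n / (1 - r).
Proof.
move=> r0 r1 h.
have cR : cvgn (fun n => complex.Re (u n)).
  apply: (is_cvg_geometric_steps _ _ _ r0 r1) => n; apply: le_trans (h n).
  by rewrite -ReB; apply: normc_Re.
have cI : cvgn (fun n => complex.Im (u n)).
  apply: (is_cvg_geometric_steps _ _ _ r0 r1) => n; apply: le_trans (h n).
  by rewrite -ImB; apply: normc_Im.
pose l := limn (fun n => complex.Re (u n)) +i* limn (fun n => complex.Im (u n)).
have ul : u @ \oo --> l.
  apply/cvgcP => e e0.
  have e2 : 0 < e / 2 by lra.
  move/cvgrPdistC_lt: cR => /(_ _ e2) hR.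
  move/cvgrPdistC_lt: cI => /(_ _ e2) hI.
  near=> n; apply: le_lt_trans (normc_le_ReIm _) _; rewrite ReB ImB /=.
  have : `|complex.Re (u n) - limn (fun n => complex.Re (u n))| < e / 2 by near: n.
  have : `|complex.Im (u n) - limn (fun n => complex.Im (u n))| < e / 2 by near: n.
  lra.
exists l => // n.
apply: (@normc_cvg_le _ (fun k => u k - u n)).
  apply: (cvgB ul); apply: cvg_cst.
near=> k.
have kn : (n <= k)%N by near: k; exists n.
have C0 : 0 <= C by have := h 0%N; rewrite expr0 mulr1; apply: le_trans (normc_ge0 _).
rewrite -(subnK kn); move: (k - n)%N => m.
(* The partial geometric sum is kept, since the induction on [m] does not close with its upper bound
   1 / (1 - r). *)
suff : normc (u (m + n)%N - u n) <= C * r ^+ n * (1 - r ^+ m) / (1 - r).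
  move/le_trans; apply; rewrite ler_wpM2r ?invr_ge0 ?subr_ge0 ?(ltW r1) //.
  by rewrite ler_piMr ?mulr_ge0 ?exprn_ge0 // gerBl exprn_ge0.
elim: m => [|m IH].
  by rewrite add0n subrr normc0 expr0 subrr mulr0 mul0r.
have -> : u (m.+1 + n)%N - u n = (u (m + n).+1 - u (m + n)%N) + (u (m + n)%N - u n).
  by rewrite addSn; ring.
apply: (le_trans (normcD_le _ _)); apply: (le_trans (lerD (h _) IH)).
have r1' : 1 - r != 0 by rewrite subr_eq0 eq_sym lt_eqF.
rewrite exprD exprS le_eqVlt; apply/orP; left; apply/eqP; field.
exact: r1'.
Unshelve. all: by end_near.
Qed.

Lemma continuous_normc {R : realType} : continuous (@normc R : R[i] -> R).
Proof.
move=> x; apply/(@cvgrPdistC_lt _ _ _ (nbhs x) (nbhs_filter x)) => e e0.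
exists e%:C; first by rewrite /= ltcR.
move=> y /=; rewrite -[`|x - y|]/((normc (x - y))%:C) ltcR; apply: le_lt_trans.
have := normcB_le x (x - y); rewrite subKr => h1.
have := normcD_le (x - y) y; rewrite subrK => h2.
by rewrite ler_norml; lra.
Qed.

Lemma compact_normc_bounded {R : realType} (K : set R[i]) : compact K ->
  exists2 M : R, 0 <= M & forall x, K x -> normc x <= M.
Proof.
move=> cK.
have /compact_bounded [N [_ hN]] : compact ((@normc R : R[i] -> R) @` K).
  apply: continuous_compact => //; apply: continuous_subspaceT.
  exact: continuous_normc.
exists (`|N| + 1); first by rewrite addr_ge0.
move=> x Kx; have hlt : N < `|N| + 1 by apply: le_lt_trans (ler_norm N) _; lra.
have := hN _ hlt (normc x); rewrite /= => H.
apply: le_trans (ler_norm _) _; apply: H.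
by exists x.
Qed.

(** * Finite and infinite q-Pochhammer symbols *)

Lemma qpochS {R : realType} (a : R[i]) (p : R) n :
  qpoch a p n.+1 = qpoch a p n * (1 - a * (p ^+ n)%:C).
Proof. by rewrite /qpoch big_ord_recr. Qed.

Lemma qpoch0 {R : realType} (a : R[i]) (p : R) : qpoch a p 0 = 1.
Proof. by rewrite /qpoch big_ord0. Qed.

Lemma qpochSl {R : realType} (a : R[i]) (p : R) n :
  qpoch a p n.+1 = (1 - a) * qpoch (a * p%:C) p n.
Proof.
rewrite /qpoch big_ord_recl /= expr0 mulr1; congr (_ * _).
by apply: eq_bigr => i _; rewrite /bump /= add1n exprS rmorphM /= mulrA.
Qed.

(** An upper bound for the product of all 1 + M p^j, from 1 + t <= exp t and the geometric
    series. *)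
Definition qbound {R : realType} (p M : R) : R := expR (M / (1 - p)).

Section QPochhammer.
Context {R : realType} {p : R}.
Hypotheses (p0 : 0 < p) (p1 : p < 1).

Let p1' : 0 < 1 - p. Proof. by rewrite subr_gt0. Qed.

Lemma qbound_gt0 M : 0 < qbound p M. Proof. exact: expR_gt0. Qed.

Lemma normc_qpoch_le (a : R[i]) (M : R) n :
  normc a <= M -> normc (qpoch a p n) <= qbound p M.
Proof.
move=> aM; have M0 : 0 <= M by apply: le_trans aM; apply: normc_ge0.
suff : normc (qpoch a p n) <= expR (M * (1 - p ^+ n) / (1 - p)).
  move/le_trans; apply; rewrite ler_expR ler_pM2r ?invr_gt0 //.
  by rewrite ler_piMr // gerBl exprn_ge0 // ltW.
elim: n => [|n IH].
  by rewrite qpoch0 normc1 expr0 subrr mulr0 mul0r expR0.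
rewrite qpochS normcM.
have -> : M * (1 - p ^+ n.+1) / (1 - p) = M * (1 - p ^+ n) / (1 - p) + M * p ^+ n.
  by rewrite exprS; field; rewrite gt_eqF.
rewrite expRD; apply: ler_pM; rewrite ?normc_ge0 //.
apply: le_trans (expR_ge1Dx _); apply: le_trans (normcB_le _ _) _.
rewrite normc1 lerD2l normcM normcR ger0_norm ?exprn_ge0 ?(ltW p0) //.
by rewrite ler_wpM2r // exprn_ge0 // ltW.
Qed.

(** Consecutive partial products differ by a p^n (a; p)_n. [M] is kept apart from [normc a]: the
    constant [qbound p M] is uniform for bounded a, while the factor [normc a] makes (a; p)_oo - 1
    small with a. *)
Lemma qpoch_inf_exists (a : R[i]) (M : R) : normc a <= M ->
  exists2 l : R[i], qpoch a p @ \oo --> l &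
    forall n, normc (l - qpoch a p n) <= qbound p M * normc a * p ^+ n / (1 - p).
Proof.
move=> aM; apply: (cvgc_geometric_steps _ _ _ (ltW p0) p1) => n.
rewrite qpochS mulrBr mulr1 addrC addKr normc_opp mulrA !normcM normcR.
rewrite ger0_norm ?exprn_ge0 ?(ltW p0) // ler_wpM2r ?exprn_ge0 ?(ltW p0) //.
by rewrite ler_wpM2r ?normc_ge0 // normc_qpoch_le.
Qed.

Lemma cvg_qpoch (a : R[i]) : qpoch a p @ \oo --> qpoch_inf a p.
Proof.
have [l h _] := qpoch_inf_exists _ _ (lexx (normc a)).
by rewrite /qpoch_inf (limnc_eq _ _ h).
Qed.

Lemma qpoch_inf_dist1 (a : R[i]) (M : R) : normc a <= M ->
  normc (qpoch_inf a p - 1) <= qbound p M * normc a / (1 - p).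
Proof.
move=> aM; have [l h /(_ 0%N)] := qpoch_inf_exists _ _ aM.
by rewrite /qpoch_inf (limnc_eq _ _ h) qpoch0 expr0 mulr1.
Qed.

Lemma normc_qpoch_inf_le (a : R[i]) (M : R) :
  normc a <= M -> normc (qpoch_inf a p) <= qbound p M.
Proof.
move=> aM; apply: normc_cvg_le (cvg_qpoch a) _.
by apply: nearW => n; apply: normc_qpoch_le.
Qed.

Lemma qpoch_infS (a : R[i]) :
  qpoch_inf a p = (1 - a) * qpoch_inf (a * p%:C) p.
Proof.
have h : (fun n => qpoch a p (n + 1)) @ \oo --> qpoch_inf a p.
  by rewrite (cvg_shiftn 1 (qpoch a p)); apply: cvg_qpoch.
apply: (cvgc_uniq h).
under eq_fun do rewrite addn1 qpochSl.
by apply: cvgM; [apply: cvg_cst | apply: cvg_qpoch].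
Qed.

Lemma qpoch_inf_split (a : R[i]) n :
  qpoch_inf a p = qpoch a p n * qpoch_inf (a * (p ^+ n)%:C) p.
Proof.
elim: n => [|n IH]; first by rewrite qpoch0 expr0 mul1r mulr1.
by rewrite IH qpoch_infS qpochS exprSr rmorphM /= !mulrA.
Qed.

Lemma exprn_lt_ex (C e : R) : 0 < e -> exists n, C * p ^+ n < e.
Proof.
move=> e0.
have h : (fun n => C * p ^+ n) @ \oo --> (0 : R).
  by apply: cvg_geometric; rewrite ger0_norm ?ltW.
move/cvgrPdistC_lt: h => /(_ _ e0) h.
near (\oo : set_system nat) => n; exists n.
have : `|C * p ^+ n - 0| < e by near: n.
by rewrite subr0; apply: le_lt_trans; apply: ler_norm.
Unshelve. all: by end_near.
Qed.

Lemma sub1_neq0 (w : R[i]) : normc w < 1 -> 1 - w != 0.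
Proof.
by move=> w1; apply/eqP => /subr0_eq w0; rewrite -w0 normc1 ltxx in w1.
Qed.

Lemma exprnp_le1 n : p ^+ n <= 1.
Proof. by rewrite exprn_ile1 // ltW. Qed.

Lemma normc_mulp_le (w : R[i]) n : normc (w * (p ^+ n)%:C) <= normc w.
Proof.
rewrite normcM normcR ger0_norm ?exprn_ge0 ?(ltW p0) //.
by rewrite ler_piMr ?normc_ge0 ?exprnp_le1.
Qed.

Lemma qpoch_neq0 (w : R[i]) n : normc w < 1 -> qpoch w p n != 0.
Proof.
move=> w1; elim: n => [|n IH]; first by rewrite qpoch0 oner_neq0.
rewrite qpochS mulf_neq0 // sub1_neq0 //.
by apply: le_lt_trans w1; apply: normc_mulp_le.
Qed.

(** A limit of nonzero products could still vanish. Splitting off n factors leaves (w p^n; p)_oo,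
    which lies at distance less than 1 from 1 for a suitable n. *)
Lemma qpoch_inf_neq0 (w : R[i]) : normc w < 1 -> qpoch_inf w p != 0.
Proof.
move=> w1; have [n hn] := exprn_lt_ex (qbound p (normc w) * normc w / (1 - p)) _ ltr01.
rewrite (qpoch_inf_split w n) mulf_neq0 ?qpoch_neq0 //; apply/eqP => h.
have := qpoch_inf_dist1 _ _ (normc_mulp_le w n).
rewrite h sub0r normc_opp normc1 normcM normcR ger0_norm ?exprn_ge0 ?(ltW p0) //.
have -> : qbound p (normc w) * (normc w * p ^+ n) / (1 - p) =
          qbound p (normc w) * normc w / (1 - p) * p ^+ n by ring.
by move=> /le_lt_trans/(_ hn); rewrite ltxx.
Qed.

(** The infinite product is the finite one times a tail of modulus at most [qbound p 1]. This yields
    a lower bound uniform in n, needed for the denominators (p; p)_k. *)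
Lemma normc_qpoch_ge (w : R[i]) n : normc w < 1 ->
  normc (qpoch_inf w p) / qbound p 1 <= normc (qpoch w p n).
Proof.
move=> w1; rewrite ler_pdivrMr ?qbound_gt0 // (qpoch_inf_split w n) normcM.
rewrite ler_wpM2l ?normc_ge0 // normc_qpoch_inf_le //.
by apply: le_trans (ltW w1); apply: normc_mulp_le.
Qed.

End QPochhammer.

(* The quadratic polynomial G with
     z (1 - a u) (1 - s u) G(p u) - (1 - u) (1 + a s p u) G(u) = F(u),
   found by comparing coefficients of u, where F(p^k) is the k-th term of the
   difference of the two sides of qsum_contiguous below, divided by the factor
   (a p)_{k-1} (s)_k / (p)_k (- a s p^{k+2})_oo z^k common to all of its summands. *)
Definition certificate {F : fieldType} (a p s z v : F) : F :=
  - ((1 - a) * (1 - a * z * p ^+ 2))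
  + (a * (1 - a * z * p ^+ 2) * (1 - a * z)
     + s * (a ^+ 2 - (a ^+ 2 - a * p - a ^+ 2 * p ^+ 2 + a ^+ 3 * p ^+ 2) * z
            - a ^+ 2 * p * z ^+ 2)) * v
  - (1 + a * p) * (1 - a * z) * a ^+ 2 * z * p * s * v ^+ 2.

(** Here u is p^k and T is the k-th term with a p^2 in place of a; the terms with a and a p are
    rational multiples of it, and the factors u and u^2 come from replacing z by z p and z p^2. In
    the first summand on the right, the term of index k + 1 has already been expressed through T. *)
Lemma telescoping_certificate (F : fieldType) (a p s z u T : F) :
  1 - a * u != 0 -> 1 - a * p * u != 0 ->
  let G := certificate a p s z in
  (1 - z) * (1 - a * z * p ^+ 2)
    * ((1 - a) * (1 - a * p) * (1 + a * s * u) * (1 + a * s * p * u) * T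
       / ((1 - a * u) * (1 - a * p * u)))
  - ((1 - a * z) * (1 - a * z * p ^+ 2) + (a - z) * (1 + a * z * p) * s)
    * (1 - a * z * p) * (u * ((1 - a * p) * (1 + a * s * p * u) * T / (1 - a * p * u)))
  - (1 - a ^+ 2 * p ^+ 2) * (1 + z * p) * (a * z * p * s ^+ 2) * (1 - a * z)
    * (u ^+ 2 * T)
  = G (p * u) * (1 - a * p) * (1 - s * u) * z * T / (1 - a * p * u)
    - (1 - u) * (1 + a * s * p * u) * G u * (1 - a * p) * T
      / ((1 - a * u) * (1 - a * p * u)).
Proof. by move=> h1 h2 /=; rewrite /certificate; field; rewrite h1 h2. Qed.

(* With a = p^(al+1), z = p^(be+1) and s = p^(1/2) y, this is the k-th term of the
   series in Phi. *)
Definition qterm {R : realType} (p : R) (a z s : R[i]) (k : nat) : R[i] :=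
  qpoch a p k * qpoch s p k / qpoch p%:C p k * z ^+ k
  * qpoch_inf (- (a * s * (p ^+ k)%:C)) p.

Definition qsum {R : realType} (p : R) (a z s : R[i]) : R[i] :=
  limn (series (qterm p a z s)).

(** The four factors bound, in order, (a)_k with |a| <= 1, (s)_k with |s| <= M, 1 / (p)_k, and the
    infinite product. *)
Definition qterm_bound {R : realType} (p M : R) : R :=
  qbound p 1 * qbound p M * (qbound p 1 / normc (qpoch_inf p%:C p)) * qbound p M.

(** * Convergence and term ratios of the bare series *)

Section QSum.
Context {R : realType} {p : R}.
Hypotheses (p0 : 0 < p) (p1 : p < 1).

Let normcp : normc p%:C < 1.
Proof. by rewrite normcR ger0_norm // ltW. Qed.

Lemma qterm_bound_ge0 (M : R) : 0 <= qterm_bound p M.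
Proof. by rewrite /qterm_bound !mulr_ge0 ?invr_ge0 ?normc_ge0 ?ltW ?qbound_gt0. Qed.

Lemma normc_qterm_le (a z s : R[i]) (M : R) k :
  normc a <= 1 -> normc s <= M ->
  normc (qterm p a z s k) <= qterm_bound p M * normc z ^+ k.
Proof.
move=> a1 sM.
have qp0 : 0 < normc (qpoch_inf p%:C p).
  rewrite lt_neqAle normc_ge0 andbT eq_sym.
  by apply: contra_neq (qpoch_inf_neq0 p0 p1 _ normcp) => /eq0_normc.
rewrite /qterm !normcM normcX normcV /qterm_bound [leLHS]mulrAC.
rewrite ler_wpM2r ?exprn_ge0 ?normc_ge0 //.
have h : (normc (qpoch p%:C p k))^-1 <= qbound p 1 / normc (qpoch_inf p%:C p).
  rewrite -[leRHS]invrK invf_div lef_pV2 ?posrE ?divr_gt0 ?qbound_gt0 //.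
    exact: normc_qpoch_ge.
  rewrite lt_neqAle normc_ge0 andbT eq_sym.
  by apply: contra_neq (qpoch_neq0 p0 p1 _ k normcp) => /eq0_normc.
rewrite !ler_pM ?mulr_ge0 ?invr_ge0 ?normc_ge0 ?normc_qpoch_le //.
apply: normc_qpoch_inf_le => //.
rewrite normc_opp; apply: le_trans (normc_mulp_le p0 p1 _ _) _.
by rewrite normcM; apply: le_trans sM; rewrite ler_piMl ?normc_ge0.
Qed.

Lemma qsum_exists (a z s : R[i]) (M : R) :
  normc a <= 1 -> normc z < 1 -> normc s <= M ->
  exists2 l : R[i], series (qterm p a z s) @ \oo --> l &
   forall n, normc (l - series (qterm p a z s) n)
             <= qterm_bound p M * normc z ^+ n / (1 - normc z).
Proof.
move=> a1 z1 sM; apply: (cvgc_geometric_steps _ _ _ (normc_ge0 z) z1) => n.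
by rewrite seriesSB normc_qterm_le.
Qed.

Lemma cvg_qsum (a z s : R[i]) : normc a <= 1 -> normc z < 1 ->
  series (qterm p a z s) @ \oo --> qsum p a z s.
Proof.
move=> a1 z1; have [l h _] := qsum_exists _ _ _ _ a1 z1 (lexx (normc s)).
by rewrite /qsum (limnc_eq _ _ h).
Qed.

(** The term k = 0 is exactly (- a s; p)_oo, so the remainder after one term is of order z. *)
Lemma qsum_dist (a z s : R[i]) (M : R) :
  normc a <= 1 -> normc z < 1 -> normc s <= M ->
  normc (qsum p a z s - qpoch_inf (- (a * s)) p)
    <= qterm_bound p M * normc z / (1 - normc z).
Proof.
move=> a1 z1 sM; have [l h /(_ 1%N)] := qsum_exists _ _ _ _ a1 z1 sM.
rewrite /qsum (limnc_eq _ _ h) expr1 /series /= big_nat1 /qterm.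
by rewrite !qpoch0 !expr0 divr1 !mul1r mulr1.
Qed.

Lemma cvg_qterm0 (a z s : R[i]) : normc a <= 1 -> normc z < 1 ->
  qterm p a z s @ \oo --> 0.
Proof.
move=> a1 z1; apply: cvg_series_cvg_0.
apply: (cvgP (qsum p a z s)); exact: cvg_qsum.
Qed.

Lemma cvg_expnC : (fun k => (p ^+ k)%:C) @ \oo --> (0 : R[i]).
Proof.
apply/cvgcP => e e0.
have h : (fun n => p ^+ n) @ \oo --> (0 : R).
  by apply: cvg_expr; rewrite ger0_norm ?ltW.
move/cvgrPdistC_lt: h => /(_ _ e0); apply: filterS => n.
by rewrite !subr0 normcR.
Qed.

Lemma qterm_scale (a z s : R[i]) n k :
  qterm p a (z * (p ^+ n)%:C) s k = (p ^+ k)%:C ^+ n * qterm p a z s k.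
Proof.
rewrite /qterm exprMn -!rmorphXn /= -!exprM mulnC; ring.
Qed.

(** Passing from a to a p changes (a)_k by a rational factor and removes the first factor of (- a s
    p^k; p)_oo. Such shifts reduce the contiguous relation to an identity of rational functions in
    p^k. *)
Lemma qterm_shift (a z s : R[i]) k : 1 - a * (p ^+ k)%:C != 0 ->
  qterm p a z s k = (1 - a) * (1 + a * s * (p ^+ k)%:C)
     * qterm p (a * p%:C) z s k / (1 - a * (p ^+ k)%:C).
Proof.
move=> h; rewrite /qterm (qpoch_infS p0 p1 (- (a * s * _))) opprK.
have -> : - (a * s * (p ^+ k)%:C) * p%:C = - (a * p%:C * s * (p ^+ k)%:C) by ring.
have e : qpoch a p k = (1 - a) * qpoch (a * p%:C) p k / (1 - a * (p ^+ k)%:C).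
  by rewrite -qpochSl qpochS mulfK.
by rewrite e; ring.
Qed.

(** The term ratio is stated without division, since 1 + a s p^k vanishes for certain s. *)
Lemma qtermS (a z s : R[i]) k :
  (1 - p%:C * (p ^+ k)%:C) * (1 + a * s * (p ^+ k)%:C) * qterm p a z s k.+1 =
  (1 - a * (p ^+ k)%:C) * (1 - s * (p ^+ k)%:C) * z * qterm p a z s k.
Proof.
have h : 1 - p%:C * (p ^+ k)%:C != 0.
  apply: sub1_neq0; apply: le_lt_trans (normc_mulp_le p0 p1 _ _) normcp.
rewrite /qterm !qpochS exprS [in RHS](qpoch_infS p0 p1) opprK.
have -> : - (a * s * (p ^+ k)%:C) * p%:C = - (a * s * (p ^+ k.+1)%:C).
  by rewrite exprS rmorphM /=; ring.
by field; rewrite h (qpoch_neq0 p0 p1).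
Qed.

End QSum.

(** * The contiguous relation for the bare series *)

Section Contiguity.
Context {R : realType} {p : R}.
Hypotheses (p0 : 0 < p) (p1 : p < 1).

Lemma qsum_contiguous (a z s : R[i]) : normc a < 1 -> normc z < 1 ->
  (1 - z) * (1 - a * z * p%:C ^+ 2) * qsum p a z s =
  ((1 - a * z) * (1 - a * z * p%:C ^+ 2) + (a - z) * (1 + a * z * p%:C) * s)
    * (1 - a * z * p%:C) * qsum p (a * p%:C) (z * p%:C) s
  + (1 - a ^+ 2 * p%:C ^+ 2) * (1 + z * p%:C) * (a * z * p%:C * s ^+ 2) * (1 - a * z)
    * qsum p (a * p%:C ^+ 2) (z * p%:C ^+ 2) s.
Proof.
move=> a1 z1; set c0 := (1 - z) * _; set c1 := _ * (1 - a * z * p%:C).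
set c2 := _ * (1 - a * z).
have ap n : normc (a * p%:C ^+ n) < 1.
  by rewrite -rmorphXn; apply: le_lt_trans (normc_mulp_le p0 p1 _ _) a1.
have zp n : normc (z * p%:C ^+ n) < 1.
  by rewrite -rmorphXn; apply: le_lt_trans (normc_mulp_le p0 p1 _ _) z1.
pose u k : R[i] := (p ^+ k)%:C.
have au k : 1 - a * u k != 0.
  by apply: sub1_neq0; apply: le_lt_trans (normc_mulp_le p0 p1 _ _) a1.
have apu k : 1 - a * p%:C * u k != 0.
  by apply: sub1_neq0; apply: le_lt_trans (normc_mulp_le p0 p1 _ _) (ap 1%N).
have uS k : u k.+1 = p%:C * u k by rewrite /u exprS rmorphM.
pose T := qterm p (a * p%:C ^+ 2) z s.
(* The antidifference of [F]. Its factor 1 - p^k vanishes at k = 0, so the telescoped sum has no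
   lower boundary term. *)
pose D k := (1 - u k) * (1 + a * s * p%:C * u k) * certificate a p%:C s z (u k)
  * (1 - a * p%:C) / ((1 - a * u k) * (1 - a * p%:C * u k)) * T k.
pose F k := c0 * qterm p a z s k - c1 * qterm p (a * p%:C) (z * p%:C) s k
            - c2 * qterm p (a * p%:C ^+ 2) (z * p%:C ^+ 2) s k.
have T1 k : qterm p (a * p%:C) z s k =
    (1 - a * p%:C) * (1 + a * s * p%:C * u k) * T k / (1 - a * p%:C * u k).
  rewrite (qterm_shift p0 p1 _ _ _ _ (apu k)) -/(u k) /T.
  have -> : a * p%:C * p%:C = a * p%:C ^+ 2 by ring.
  by congr (_ / _); ring.
have T0 k : qterm p a z s k =
    (1 - a) * (1 - a * p%:C) * (1 + a * s * u k) * (1 + a * s * p%:C * u k) * T k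
      / ((1 - a * u k) * (1 - a * p%:C * u k)).
  rewrite (qterm_shift p0 p1 _ _ _ _ (au k)) -/(u k) T1.
  by field; rewrite au apu.
have FD k : F k = D k.+1 - D k.
  rewrite /F T0 -{1}[p%:C]expr1 -{1}[z * p%:C]/(z * p%:C ^+ 1).
  have -> : z * p%:C ^+ 1 = z * (p ^+ 1)%:C by rewrite rmorphXn.
  have -> : z * p%:C ^+ 2 = z * (p ^+ 2)%:C by rewrite rmorphXn.
  rewrite !qterm_scale expr1 T1 -/(T k) -/(u k).
  rewrite (telescoping_certificate _ a p%:C s z (u k) (T k) (au k) (apu k)).
  have hS := qtermS p0 p1 (a * p%:C ^+ 2) z s k; rewrite -/T -/(u k) in hS.
  have apu1 := apu k.+1; rewrite uS in apu1.
  have apu0 := apu k; have au0 := au k.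
  (* The last factor is arranged to be the left side of the term ratio [hS]. *)
  have -> : D k.+1 = certificate a p%:C s z (p%:C * u k) * (1 - a * p%:C)
      / ((1 - a * p%:C * u k) * (1 - a * p%:C * (p%:C * u k)))
      * ((1 - p%:C * u k) * (1 + a * p%:C ^+ 2 * s * u k) * T k.+1).
    rewrite /D uS mulrA (_ : a * (p%:C * u k) = a * p%:C * u k); last by ring.
    by ring.
  rewrite hS /D; set g := certificate _ _ _ _ (u k); set g' := certificate _ _ _ _ _.
  by field; rewrite apu1 apu0 au0.
have cu := cvg_expnC p0 p1; rewrite -/u in cu.
have cT : T @ \oo --> 0.
  by apply: cvg_qterm0 => //; apply: ltW.
(* The rational factor of [D] has the finite limit [l], as its denominator tends to 1, and [T] tends
   to 0; so there is no upper boundary term either. *)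
have cD : D @ \oo --> 0.
  pose l : R[i] := (1 - 0) * (1 + a * s * p%:C * 0) * certificate a p%:C s z 0
    * (1 - a * p%:C) / ((1 - a * 0) * (1 - a * p%:C * 0)).
  rewrite -(mulr0 l); apply: (cvgM _ cT).
  have lin (c d : R[i]) : (fun k => c + d * u k) @ \oo --> c + d * 0.
    by apply: cvgD; [apply: cvg_cst|apply: cvgM cu; apply: cvg_cst].
  have linN (c d : R[i]) : (fun k => c - d * u k) @ \oo --> c - d * 0.
    by apply: cvgB; [apply: cvg_cst|apply: cvgM cu; apply: cvg_cst].
  apply: cvgM.
    apply: cvgM; last exact: cvg_cst.
    apply: cvgM; last first.
      apply: cvgB; first exact: lin.
      apply: cvgM; first exact: cvg_cst.
      by apply: cvgM.
    apply: cvgM; last exact: lin.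
    by have := linN 1 1; rewrite !mul1r; under eq_fun do rewrite mul1r.
  apply: (@cvgV _ _ _ _ (fun k => (1 - a * u k) * (1 - a * p%:C * u k))).
    by rewrite !mulr0 subr0 mulr1 oner_neq0.
  by apply: cvgM; apply: linN.
have sF n : series F n = D n.
  rewrite /series /= (@telescope_sumr_eq _ 0 n D F) //.
  have -> : D 0%N = 0 by rewrite /D /u expr0 subrr !mul0r.
  by rewrite subr0.
have sF' n : series F n = c0 * series (qterm p a z s) n
    - c1 * series (qterm p (a * p%:C) (z * p%:C) s) n
    - c2 * series (qterm p (a * p%:C ^+ 2) (z * p%:C ^+ 2) s) n.
  by rewrite /series /= !mulr_sumr -!sumrB.
have cF : series F @ \oo --> c0 * qsum p a z s - c1 * qsum p (a * p%:C) (z * p%:C) s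
    - c2 * qsum p (a * p%:C ^+ 2) (z * p%:C ^+ 2) s.
  rewrite (funext sF').
  have ap1 := ap 1%N; have zp1 := zp 1%N; rewrite expr1 in ap1 zp1.
  have h0 := cvg_qsum p0 p1 _ _ s (ltW a1) z1.
  have h1 := cvg_qsum p0 p1 _ _ s (ltW ap1) zp1.
  have h2 := cvg_qsum p0 p1 _ _ s (ltW (ap 2%N)) (zp 2%N).
  apply: cvgB; last by apply: cvgM h2; apply: cvg_cst.
  by apply: cvgB; [apply: cvgM h0; apply: cvg_cst | apply: cvgM h1; apply: cvg_cst].
rewrite (funext sF) in cF.
have /eqP := cvgc_uniq cF cD.
by rewrite -addrA -opprD subr_eq0 => /eqP.
Qed.

End Contiguity.

(** * The recurrence for x^n b_n(1/x) and boundedness of its solutions *)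

Definition rev_eval {R : realType} (n : nat) (P : {poly R[i]}) (x : R[i]) : R[i] :=
  \sum_(i < n.+1) P`_i * x ^+ (n - i).

Lemma rev_evalD {R : realType} n (P Q : {poly R[i]}) x :
  rev_eval n (P + Q) x = rev_eval n P x + rev_eval n Q x.
Proof. by rewrite /rev_eval -big_split; apply: eq_bigr => i _; rewrite coefD mulrDl. Qed.

Lemma rev_evalC {R : realType} n (c : R[i]) (P : {poly R[i]}) x :
  rev_eval n (c%:P * P) x = c * rev_eval n P x.
Proof. by rewrite /rev_eval mulr_sumr; apply: eq_bigr => i _; rewrite coefCM mulrA. Qed.

Lemma rev_evalX {R : realType} n (P : {poly R[i]}) x :
  rev_eval n.+1 ('X * P) x = rev_eval n P x.
Proof.
rewrite /rev_eval big_ord_recl coefXM mul0r add0r.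
by apply: eq_bigr => i _; rewrite coefXM.
Qed.

(** The reversal degree may exceed that of the polynomial, so that all terms of the recurrence are
    reversed at the same degree. Each unit of excess costs a factor x, whence the x^2 in front of
    r_n. *)
Lemma rev_evalS {R : realType} n (P : {poly R[i]}) x : (size P <= n.+1)%N ->
  rev_eval n.+1 P x = x * rev_eval n P x.
Proof.
move=> sP; rewrite /rev_eval big_ord_recr /= nth_default // mul0r addr0 mulr_sumr.
apply: eq_bigr => i _; rewrite subSn -1?ltnS //.
by rewrite exprS mulrCA.
Qed.

Lemma bpolySS {R : realType} (p al be : R) n :
  bpoly p al be n.+2 = ('X + ((bA p al be n.+1)%:C)%:P) * bpoly p al be n.+1
                       + ((bB p al be n.+1)%:C)%:P * bpoly p al be n.
Proof. by []. Qed.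

Lemma bpoly1 {R : realType} (p al be : R) :
  bpoly p al be 1 = 'X + ((bA p al be 0)%:C)%:P.
Proof. by rewrite /bpoly /= mulr1 mulr0 addr0. Qed.

Lemma size_bpoly {R : realType} (p al be : R) n :
  (size (bpoly p al be n) <= n.+1)%N /\ (size (bpoly p al be n.+1) <= n.+2)%N.
Proof.
elim: n => [|n [IH0 IH1]].
  by rewrite bpoly1 size_XaddC /bpoly /= size_poly1.
split=> //; rewrite bpolySS (leq_trans (size_polyD _ _)) // geq_max; apply/andP; split.
  apply: leq_trans (size_polyMleq _ _) _; rewrite size_XaddC /=.
  exact: IH1.
rewrite mul_polyC (leq_trans (size_scale_leq _ _)) //.
by apply: leq_trans IH0 _; rewrite !ltnS leqW.
Qed.

Lemma bresE {R : realType} (p al be : R) n x :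
  bres p al be n x = rev_eval n (bpoly p al be n) x.
Proof. by []. Qed.

Lemma bres0 {R : realType} (p al be : R) x : bres p al be 0 x = 1.
Proof. by rewrite /bres /bpoly /= big_ord_recl big_ord0 coef1 /= mulr1 addr0. Qed.

Lemma bres1 {R : realType} (p al be : R) x :
  bres p al be 1 x = 1 + (bA p al be 0)%:C * x.
Proof.
rewrite /bres bpoly1 !big_ord_recl big_ord0 /= !coefD !coefX !coefC /=.
by rewrite add0r !addr0 expr1 expr0 mulr1 addrC.
Qed.

Lemma bresSS {R : realType} (p al be : R) n x :
  bres p al be n.+2 x = (1 + (bA p al be n.+1)%:C * x) * bres p al be n.+1 x
                        + (bB p al be n.+1)%:C * x ^+ 2 * bres p al be n x.
Proof.
have [s0 s1] := size_bpoly p al be n.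
rewrite !bresE bpolySS mulrDl 2![in LHS]rev_evalD rev_evalX 2![in LHS]rev_evalC.
rewrite (rev_evalS n.+1) // (rev_evalS n.+1 (bpoly p al be n)); last exact: leqW.
by rewrite (rev_evalS n (bpoly p al be n)) //; ring.
Qed.

(** A discrete Gronwall argument: a common bound for two consecutive terms grows at step n by at
    most the factor 1 + D p^n, and the product of these factors is (-D; p)_n. *)
Lemma three_term_bounded {R : realType} (p : R) (u al be : nat -> R[i]) (D Y : R) :
  0 < p -> p < 1 ->
  (forall n, u n.+2 = (1 + al n) * u n.+1 + be n * u n) ->
  (forall n, normc (al n) + normc (be n) <= D * p ^+ n) ->
  normc (u 0%N) <= Y -> normc (u 1%N) <= Y ->
  forall n, normc (u n) <= Y * qbound p D.
Proof.
move=> p0 p1 rec hD u0 u1.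
have D0 : 0 <= D.
  have := hD 0%N; rewrite expr0 mulr1; apply: le_trans.
  by rewrite addr_ge0 ?normc_ge0.
have Y0 : 0 <= Y by apply: le_trans u0; apply: normc_ge0.
pose q n := normc (qpoch (- D%:C) p n).
have qS n : q n.+1 = q n * (1 + D * p ^+ n).
  rewrite /q qpochS normcM mulNr opprK.
  have -> : 1 + D%:C * (p ^+ n)%:C = (1 + D * p ^+ n)%:C by rewrite rmorphD rmorphM.
  rewrite normcR ger0_norm //.
  by rewrite addr_ge0 // mulr_ge0 // exprn_ge0 // ltW.
have q_le n : q n <= qbound p D.
  by apply: normc_qpoch_le => //; rewrite normc_opp normcR ger0_norm.
suff h n : normc (u n) <= Y * q n /\ normc (u n.+1) <= Y * q n.
  by move=> n; apply: le_trans (h n).1 _; rewrite ler_wpM2l.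
elim: n => [|n [IH0 IH1]]; first by rewrite /q qpoch0 normc1 mulr1.
have e0 : 0 <= D * p ^+ n by rewrite mulr_ge0 // exprn_ge0 // ltW.
have Yq : 0 <= Y * q n by rewrite mulr_ge0 // normc_ge0.
rewrite qS; split.
  by apply: le_trans IH1 _; rewrite mulrA ler_peMr // lerDl.
rewrite rec mulrDl mul1r -addrA; apply: le_trans (normcD_le _ _) _.
apply: le_trans (lerD IH1 (normcD_le _ _)) _.
rewrite mulrA mulrDr mulr1 lerD2l !normcM.
apply: (@le_trans _ _ ((normc (al n) + normc (be n)) * (Y * q n))).
  by rewrite mulrDl lerD // ler_wpM2l // normc_ge0.
by rewrite mulrC ler_wpM2l.
Qed.

(** * The contiguous relation for Phi *)

Lemma bA_shift {R : realType} (p al be : R) k :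
  bA p al be k = bA p (al + k%:R) (be + k%:R) 0.
Proof.
rewrite /bA; congr (_ / _ * _); repeat congr (_ * _); repeat congr (_ - _);
  rewrite ?mulr0 ?addr0; congr (_ `^ _) || congr (_ + _ `^ _); ring.
Qed.

Lemma bB_shift {R : realType} (p al be : R) k :
  bB p al be k.+1 = bB p (al + k%:R) (be + k%:R) 1.
Proof.
rewrite /bB -(natr1 k).
by congr (_ / _); repeat congr (_ * _); repeat congr (_ ^+ 2); repeat congr (_ - _);
  congr (_ `^ _); ring.
Qed.

(** The purely algebraic passage from the bare series S0, S1, S2 to Phi, with h = p^(1/2), V = (Z
    p^2; p)_oo and W = (A Z p^4; p)_oo. *)
Lemma contiguity_field (F : fieldType) (p A Z h x V W S0 S1 S2 : F) :
  h ^+ 2 = p ->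
  W != 0 -> 1 - Z != 0 -> 1 - A * Z != 0 -> 1 - A * Z * p != 0 ->
  1 - A * Z * p ^+ 2 != 0 -> 1 - A * Z * p ^+ 3 != 0 ->
  (1 - Z) * (1 - A * Z * p ^+ 2) * S0 =
  ((1 - A * Z) * (1 - A * Z * p ^+ 2) + (A - Z) * (1 + A * Z * p) * (h * x))
    * (1 - A * Z * p) * S1
  + (1 - A ^+ 2 * p ^+ 2) * (1 + Z * p) * (A * Z * p * (h * x) ^+ 2) * (1 - A * Z) * S2 ->
  (1 - Z) * (1 - Z * p) * V
    / ((1 - A * Z) * (1 - A * Z * p) * (1 - A * Z * p ^+ 2) * (1 - A * Z * p ^+ 3) * W)
    * S0 =
  (1 + (A - Z) * (1 + A * Z * p) * h / ((1 - A * Z) * (1 - A * Z * p ^+ 2)) * x)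
    * ((1 - Z * p) * V / ((1 - A * Z * p ^+ 2) * (1 - A * Z * p ^+ 3) * W) * S1)
  + (1 - A ^+ 2 * p ^+ 2) * (1 - Z ^+ 2 * p ^+ 2) * (A * Z * p ^+ 2)
    / ((1 - A * Z * p) * (1 - A * Z * p ^+ 2) ^+ 2 * (1 - A * Z * p ^+ 3))
    * x ^+ 2 * (V / W * S2).
Proof.
move=> hp W0 z0 az0 az1 az2 az3 main.
have -> : S0 = (((1 - A * Z) * (1 - A * Z * p ^+ 2)
      + (A - Z) * (1 + A * Z * p) * (h * x)) * (1 - A * Z * p) * S1
    + (1 - A ^+ 2 * p ^+ 2) * (1 + Z * p) * (A * Z * p * (h * x) ^+ 2) * (1 - A * Z) * S2)
    / ((1 - Z) * (1 - A * Z * p ^+ 2)).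
  by rewrite -main [_ * S0]mulrC mulfK // mulf_neq0.
rewrite !exprMn hp; field.
by rewrite W0 z0 az0 az1 az2 az3.
Qed.

Section Contiguous_Phi.
Context {R : realType} {p : R}.
Hypotheses (p0 : 0 < p) (p1 : p < 1).

Lemma powRDp (x y : R) : p `^ (x + y) = p `^ x * p `^ y.
Proof. by apply: powRD; rewrite (gt_eqF p0) implybT. Qed.

Lemma powRp_nat n : p `^ n%:R = p ^+ n.
Proof. by rewrite powR_mulrn // ltW. Qed.

Lemma powRp_lt1 (x : R) : 0 < x -> p `^ x < 1.
Proof.
move=> x0; rewrite [ltRHS](_ : 1 = 1 `^ x); last by rewrite powR1.
by apply: gt0_ltr_powR; rewrite ?nnegrE ?ler01 // ltW.
Qed.

Lemma cpwD (x y : R) : cpw p (x + y) = cpw p x * cpw p y.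
Proof. by rewrite /cpw powRDp rmorphM. Qed.

Lemma cpw_nat n : cpw p n%:R = (p ^+ n)%:C.
Proof. by rewrite /cpw powRp_nat. Qed.

Lemma normc_cpw_lt1 (x : R) : 0 < x -> normc (cpw p x) < 1.
Proof. by move=> x0; rewrite /cpw normcR ger0_norm ?powR_ge0 // powRp_lt1. Qed.

Lemma cpw_half_sqr : cpw p (1 / 2) ^+ 2 = p%:C.
Proof.
rewrite expr2 -cpwD (_ : 1 / 2 + 1 / 2 = 1%:R); last by field.
by rewrite cpw_nat expr1.
Qed.

Lemma PhiE (al be : R) (y : R[i]) :
  Phi p al be y =
  qpoch_inf (cpw p (be + 1)) p / qpoch_inf (cpw p (al + 1) * cpw p (be + 1)) p
  * qsum p (cpw p (al + 1)) (cpw p (be + 1)) (cpw p (1 / 2) * y).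
Proof.
rewrite /Phi /qsum -cpwD (_ : al + 1 + (be + 1) = al + be + 2); last by ring.
suff <- : Phi_term p al be y =
  qterm p (cpw p (al + 1)) (cpw p (be + 1)) (cpw p (1 / 2) * y) by [].
apply/funext => k; rewrite /Phi_term /qterm.
have -> : cpw p ((be + 1) * k%:R) = cpw p (be + 1) ^+ k.
  by rewrite /cpw powRrM powR_mulrn ?powR_ge0 // rmorphXn.
have -> : cpw p (al + 3 / 2 + k%:R) * y = cpw p (al + 1) * (cpw p (1 / 2) * y) * (p ^+ k)%:C.
  rewrite -cpw_nat (_ : al + 3 / 2 + k%:R = al + 1 + 1 / 2 + k%:R); last by field.
  by rewrite (cpwD _ k%:R) (cpwD (al + 1)); ring.
by [].
Qed.

(** The factor A in p^(al + 3/2) absorbs the denominator of 1 - Z / A. The resulting A - Z makes the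
    decay visible when A and Z shrink together. *)
Lemma bA0E (al be : R) : let A := p `^ (al + 1) in let Z := p `^ (be + 1) in
  bA p al be 0 = (A - Z) * (1 + A * Z * p) * p `^ (1 / 2)
                 / ((1 - A * Z) * (1 - A * Z * p ^+ 2)).
Proof.
move=> A Z; have A0 : A != 0 by rewrite gt_eqF // powR_gt0.
have e (x : R) n : x = al + 1 + (be + 1) + n%:R -> p `^ x = A * Z * p ^+ n.
  by move=> ->; rewrite (powRDp _ n%:R) (powRDp (al + 1)) powRp_nat.
rewrite /bA mulr0 !addr0 (e (al + be + 3) 1%N); last by ring.
rewrite (e (al + be + 2) 0%N) ?(e (al + be + 4) 2%N); [|by ring|by ring].
have -> : p `^ (be - al) = Z / A.
  apply: (mulIf A0); rewrite divfK // /A -powRDp; congr (_ `^ _); ring.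
have -> : p `^ (al + 3 / 2) = A * p `^ (1 / 2).
  by rewrite -powRDp; congr (_ `^ _); field.
rewrite expr0 mulr1 expr1 mulrAC; congr (_ / _).
by field.
Qed.

Lemma bB1E (al be : R) : let A := p `^ (al + 1) in let Z := p `^ (be + 1) in
  bB p al be 1 = (1 - A ^+ 2 * p ^+ 2) * (1 - Z ^+ 2 * p ^+ 2) * (A * Z * p ^+ 2)
    / ((1 - A * Z * p) * (1 - A * Z * p ^+ 2) ^+ 2 * (1 - A * Z * p ^+ 3)).
Proof.
move=> A Z.
have e (x : R) n : x = al + 1 + (be + 1) + n%:R -> p `^ x = A * Z * p ^+ n.
  by move=> ->; rewrite (powRDp _ n%:R) (powRDp (al + 1)) powRp_nat.
rewrite /bB mulr1 (e (2 + al + be + 2) 2%N); last by ring.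
rewrite (e (al + be + 1 + 2) 1%N) ?(e (al + be + 2 + 2) 2%N) ?(e (al + be + 3 + 2) 3%N);
  [|by ring|by ring|by ring].
have -> : p `^ (2 * al + 2 + 2) = A ^+ 2 * p ^+ 2.
  by rewrite expr2 -powRp_nat -!powRDp; congr (_ `^ _); ring.
have -> : p `^ (2 * be + 2 + 2) = Z ^+ 2 * p ^+ 2.
  by rewrite expr2 -powRp_nat -!powRDp; congr (_ `^ _); ring.
by rewrite expr1.
Qed.

Lemma Phi_contiguous (al be : R) (x : R[i]) : -1 < al -> -1 < be ->
  Phi p al be x = (1 + (bA p al be 0)%:C * x) * Phi p (al + 1) (be + 1) x
    + (bB p al be 1)%:C * x ^+ 2 * Phi p (al + 2) (be + 2) x.
Proof.
move=> al1 be1; rewrite !PhiE bA0E bB1E.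
rewrite (_ : al + 2 + 1 = al + 1 + 2%:R) 1?(_ : be + 2 + 1 = be + 1 + 2%:R);
  [|by ring|by ring].
rewrite (cpwD (al + 1) 1) (cpwD (be + 1) 1) (cpwD (al + 1) 2%:R) (cpwD (be + 1) 2%:R).
rewrite !cpw_nat (cpw_nat 1) expr1.
have h2 := cpw_half_sqr.
have a1 : normc (cpw p (al + 1)) < 1 by apply: normc_cpw_lt1; lra.
have z1 : normc (cpw p (be + 1)) < 1 by apply: normc_cpw_lt1; lra.
rewrite !(fmorphV, rmorphXn, rmorphM, rmorphB, rmorphD, rmorph1) /= -!/(cpw p _).
move: h2 a1 z1; move: (cpw p (1 / 2)) (cpw p (al + 1)) (cpw p (be + 1)) => h A Z h2 a1 z1.
have az n : 1 - A * Z * p%:C ^+ n != 0.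
  rewrite -rmorphXn; apply: sub1_neq0.
  apply: le_lt_trans (normc_mulp_le p0 p1 _ _) _; rewrite normcM.
  by rewrite mulr_ilt1 ?normc_ge0.
have z0 := sub1_neq0 _ z1.
have main := qsum_contiguous p0 p1 A Z (h * x) a1 z1.
(* Enough factors are split off for the three prefactors to share the same two infinite products, (Z
   p^2; p)_oo and (A Z p^4; p)_oo. *)
rewrite (qpoch_inf_split p0 p1 Z 2) (qpoch_inf_split p0 p1 (Z * p%:C) 1).
rewrite (qpoch_inf_split p0 p1 (A * Z) 4).
rewrite (qpoch_inf_split p0 p1 (A * p%:C * (Z * p%:C)) 2).
have W0 : qpoch_inf (A * Z * p%:C ^+ 4) p != 0.
  rewrite -rmorphXn; apply: qpoch_inf_neq0 => //.
  apply: le_lt_trans (normc_mulp_le p0 p1 _ _) _.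
  by rewrite normcM mulr_ilt1 ?normc_ge0.
rewrite !qpochS !qpoch0 !rmorphXn /= !expr1 !expr0 !mul1r !mulr1.
have -> : Z * p%:C * p%:C = Z * p%:C ^+ 2 by ring.
have -> : A * p%:C * (Z * p%:C) * p%:C ^+ 2 = A * Z * p%:C ^+ 4 by ring.
have -> : A * p%:C ^+ 2 * (Z * p%:C ^+ 2) = A * Z * p%:C ^+ 4 by ring.
have -> : A * p%:C * (Z * p%:C) * p%:C = A * Z * p%:C ^+ 3 by ring.
have -> : A * p%:C * (Z * p%:C) = A * Z * p%:C ^+ 2 by ring.
have az0 := az 0%N; have az1 := az 1%N; rewrite expr0 mulr1 in az0; rewrite expr1 in az1.
exact: contiguity_field h2 W0 z0 az0 az1 (az 2%N) (az 3%N) main.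
Qed.

End Contiguous_Phi.

(** * Geometric estimates for the coefficients and for Phi *)

Lemma ler_norm_div {R : realType} (x y N d : R) :
  `|x| <= N -> 0 < d -> d <= y -> `|x / y| <= N / d.
Proof.
move=> xN d0 dy; have y0 := lt_le_trans d0 dy.
rewrite normrM normfV (gtr0_norm y0); apply: ler_pM => //.
  by rewrite invr_ge0 ltW.
by rewrite lef_pV2 ?posrE.
Qed.

Section Asymptotics.
Context {R : realType} {p al be : R}.
Hypotheses (p0 : 0 < p) (p1 : p < 1) (al1 : -1 < al) (be1 : -1 < be).

Let A0 := p `^ (al + 1).
Let Z0 := p `^ (be + 1).

Let A0_gt0 : 0 < A0. Proof. exact: powR_gt0. Qed.
Let Z0_gt0 : 0 < Z0. Proof. exact: powR_gt0. Qed.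
Let A0_lt1 : A0 < 1. Proof. by apply: powRp_lt1 => //; rewrite -ltrBlDr sub0r. Qed.
Let Z0_lt1 : Z0 < 1. Proof. by apply: powRp_lt1 => //; rewrite -ltrBlDr sub0r. Qed.

Let powR_shift (x : R) k : p `^ (x + k%:R + 1) = p `^ (x + 1) * p ^+ k.
Proof. by rewrite (addrAC x k%:R 1) (powRDp p0 (x + 1) k%:R) powRp_nat. Qed.

Lemma bA_bB_geometric : exists2 c : R, 0 <= c & forall k,
  `|bA p al be k| <= c * p ^+ k /\ `|bB p al be k.+1| <= c * p ^+ k.
Proof.
pose d := 1 - A0 * Z0.
have w1 : A0 * Z0 < 1 by rewrite mulr_ilt1 // ltW.
have d0 : 0 < d by rewrite subr_gt0.
have d1 : d <= 1 by rewrite gerBl mulr_ge0 // ltW.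
(* Every denominator factor 1 - A Z p^n is at least [d], whatever the shift. B has four of them and
   A only two, but d <= 1 lets d^4 serve both; the 2 bounds 1 + A Z p in the numerator of A. *)
exists (2 / d ^+ 4); first by rewrite divr_ge0 // exprn_ge0 // ltW.
move=> k; rewrite bA_shift bB_shift bA0E // bB1E // !powR_shift -/A0 -/Z0.
have q0 : 0 < p ^+ k by rewrite exprn_gt0.
have q1 : p ^+ k <= 1 by rewrite exprnp_le1.
move: (p ^+ k) q0 q1 => q q0 q1.
have h0 : 0 <= p `^ (1 / 2) by apply: powR_ge0.
have h1 : p `^ (1 / 2) <= 1 by apply/ltW/powRp_lt1 => //; lra.
move: (p `^ (1 / 2)) h0 h1 => h h0 h1.
have [Aq Aq0] : A0 * q <= q /\ 0 < A0 * q by rewrite mulr_gt0 // ler_piMl // ltW.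
have [Zq Zq0] : Z0 * q <= q /\ 0 < Z0 * q by rewrite mulr_gt0 // ler_piMl // ltW.
have AZ : A0 * q * (Z0 * q) <= A0 * Z0.
  by apply: ler_pM; rewrite ?(ltW Aq0) ?(ltW Zq0) // ler_piMr // ltW.
move: (A0 * q) (Z0 * q) Aq Aq0 Zq Zq0 AZ => A Z Aq Aq0 Zq Zq0 AZ.
have AZ0 : 0 < A * Z by rewrite mulr_gt0.
have AZq : A * Z <= q.
  rewrite -[leRHS]mulr1; apply: ler_pM (ltW Aq0) (ltW Zq0) Aq _.
  exact: le_trans q1.
have pn n : 0 < p ^+ n <= 1 by rewrite exprn_gt0 // exprnp_le1.
have dn n : d <= 1 - A * Z * p ^+ n.
  rewrite lerD2l lerN2; apply: le_trans AZ; rewrite ler_piMr ?(ltW AZ0) //.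
  by case/andP: (pn n).
have dn0 := dn 0%N; have dn1 := dn 1%N; rewrite expr0 mulr1 in dn0; rewrite expr1 in dn1.
split.
  rewrite [leRHS]mulrAC (mulrC 2); apply: ler_norm_div.
  - rewrite !normrM (ger0_norm h0).
    rewrite -[leRHS]mulr1 ler_pM ?mulr_ge0 // ler_pM // ler_norml.
      by apply/andP; split; lra.
    have : A * Z * p <= 1.
      by rewrite mulr_ile1 ?(ltW p1) ?(ltW p0) ?(ltW AZ0) // (le_trans AZq).
    have : 0 < A * Z * p by rewrite mulr_gt0.
    by move=> ? ?; apply/andP; split; lra.
  - by rewrite exprn_gt0.
  - apply: (@le_trans _ _ (d * d)); last by rewrite ler_pM // ltW.
    by rewrite -expr2 ler_wiXn2l // ltW.
rewrite [leRHS]mulrAC (mulrC 2); apply: ler_norm_div.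
- have sub1 (t : R) : 0 < t <= 1 -> `|1 - t ^+ 2 * p ^+ 2| <= 1.
    move=> /andP[t0 t1]; case/andP: (pn 2%N) => s0 s1.
    have : 0 < t ^+ 2 * p ^+ 2 by rewrite mulr_gt0 ?exprn_gt0.
    have : t ^+ 2 * p ^+ 2 <= 1.
      by rewrite mulr_ile1 ?exprn_ge0 ?exprn_ile1 ?(ltW t0) ?(ltW p0) ?(ltW p1).
    by move=> ? ?; rewrite ler_norml; apply/andP; split; lra.
  rewrite normrM (normrM (1 - _) _).
  apply: (@le_trans _ _ q); last by lra.
  rewrite -[leRHS]mul1r ler_pM ?mulr_ge0 //.
    by rewrite mulr_ile1 // sub1 //; apply/andP; split=> //; lra.
  rewrite ger0_norm; last by rewrite mulr_ge0 ?exprn_ge0 ?(ltW AZ0) ?(ltW p0).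
  apply: le_trans AZq; rewrite ler_piMr ?(ltW AZ0) //.
  by case/andP: (pn 2%N).
- by rewrite exprn_gt0.
- rewrite (_ : d ^+ 4 = d * d ^+ 2 * d); last by ring.
  have ? := ltW d0; rewrite ler_pM ?mulr_ge0 ?exprn_ge0 //.
  by rewrite ler_pM ?exprn_ge0 // lerXn2r ?nnegrE //; apply: le_trans (dn 2%N).
Qed.

(** The series is within O(Z) of (- A s; p)_oo, which is within O(A) of 1, and both products of the
    prefactor are within O(p^k) of 1. *)
Lemma Phi_dist1 (M : R) : 0 <= M -> exists2 C : R, 0 <= C & forall k (x : R[i]),
  normc x <= M -> normc (Phi p (al + k%:R) (be + k%:R) x - 1) <= C * p ^+ k.
Proof.
move=> M0.
pose w : R[i] := A0%:C * Z0%:C.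
have w1 : normc w < 1.
  rewrite /w normcM !normcR !ger0_norm ?(ltW A0_gt0) ?(ltW Z0_gt0) //.
  by rewrite mulr_ilt1 // ltW.
have qw0 : 0 < normc (qpoch_inf w p).
  rewrite lt_neqAle normc_ge0 andbT eq_sym.
  by apply: contra_neq (qpoch_inf_neq0 p0 p1 _ w1) => /eq0_normc.
pose Q := qbound p 1.
have Q0 : 0 < Q by apply: qbound_gt0.
pose E := Q / (1 - p).
pose C1 := qterm_bound p M / (1 - Z0) + qbound p M * M / (1 - p).
pose L := Q / normc (qpoch_inf w p).
have p1' : 0 < 1 - p by rewrite subr_gt0.
have Z1' : 0 < 1 - Z0 by rewrite subr_gt0.
have E0 : 0 <= E by rewrite divr_ge0 // ltW.
have L0 : 0 <= L by rewrite divr_ge0 // ltW.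
have C10 : 0 <= C1.
  rewrite addr_ge0 // divr_ge0 ?qterm_bound_ge0 // ?mulr_ge0 // ltW //.
  exact: qbound_gt0.
exists ((Q * C1 + (E + E)) * L).
  by rewrite mulr_ge0 // !addr_ge0 // mulr_ge0 // ltW.
move=> k x xM; rewrite PhiE // /cpw !powR_shift -/A0 -/Z0.
set A := (A0 * _)%:C; set Z := (Z0 * _)%:C; set s := _ * x.
have q0 : 0 < p ^+ k by rewrite exprn_gt0.
have q1 : p ^+ k <= 1 by rewrite exprnp_le1.
have q00 := ltW q0; have A00 := ltW A0_gt0; have Z00 := ltW Z0_gt0.
have A01 := ltW A0_lt1; have Z01 := ltW Z0_lt1.
have nA : normc A <= p ^+ k by rewrite normcR ger0_norm ?mulr_ge0 // ler_piMl.
have nZ : normc Z <= p ^+ k by rewrite normcR ger0_norm ?mulr_ge0 // ler_piMl.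
have nZ0 : normc Z <= Z0 by rewrite normcR ger0_norm ?mulr_ge0 // ler_piMr.
have sM : normc s <= M.
  rewrite normcM; apply: le_trans xM; rewrite ler_piMl ?normc_ge0 //.
  by apply/ltW/normc_cpw_lt1 => //; lra.
have nAs : normc (- (A * s)) <= M * p ^+ k.
  by rewrite normc_opp normcM mulrC ler_pM ?normc_ge0.
have nAZ : normc (A * Z) <= p ^+ k.
  by rewrite normcM -[leRHS]mulr1 ler_pM ?normc_ge0 //; apply: le_trans q1.
have A1 : normc A <= 1 by apply: le_trans q1.
have S1 : normc (qsum p A Z s - 1) <= C1 * p ^+ k.
  have -> : qsum p A Z s - 1 = (qsum p A Z s - qpoch_inf (- (A * s)) p)
     + (qpoch_inf (- (A * s)) p - 1) by ring.
  apply: le_trans (normcD_le _ _) _; rewrite mulrDl; apply: lerD.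
    apply: le_trans (qsum_dist p0 p1 _ _ _ _ A1 (le_lt_trans nZ0 Z0_lt1) sM) _.
    have nZ1 : 0 < 1 - normc Z by rewrite subr_gt0 (le_lt_trans nZ0).
    rewrite [leRHS]mulrAC; apply: ler_pM.
    - by rewrite mulr_ge0 ?normc_ge0 ?qterm_bound_ge0.
    - by rewrite invr_ge0 ltW.
    - by rewrite ler_wpM2l ?qterm_bound_ge0.
    - by rewrite lef_pV2 ?posrE // lerD2l lerN2.
  apply: le_trans (qpoch_inf_dist1 p0 p1 _ M _) _.
    by apply: le_trans nAs _; rewrite ler_piMr.
  rewrite [leRHS]mulrAC -[qbound p M * M * _]mulrA ler_pM2r ?invr_gt0 //.
  by rewrite ler_pM2l // qbound_gt0.
have Zd : normc (qpoch_inf Z p - 1) <= E * p ^+ k.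
  apply: le_trans (qpoch_inf_dist1 p0 p1 _ 1 (le_trans nZ q1)) _.
  by rewrite /E [leRHS]mulrAC ler_pM2r ?invr_gt0 // ler_pM2l.
have AZd : normc (qpoch_inf (A * Z) p - 1) <= E * p ^+ k.
  apply: le_trans (qpoch_inf_dist1 p0 p1 _ 1 (le_trans nAZ q1)) _.
  by rewrite /E [leRHS]mulrAC ler_pM2r ?invr_gt0 // ler_pM2l.
have Zle : normc (qpoch_inf Z p) <= Q.
  by apply: normc_qpoch_inf_le => //; apply: le_trans q1.
(* (A Z; p)_oo is a tail of the fixed nonzero product (w; p)_oo, which bounds it away from 0
   uniformly in k. *)
have AZw : normc (qpoch_inf w p) <= Q * normc (qpoch_inf (A * Z) p).
  have -> : A * Z = w * (p ^+ (k + k))%:C.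
    by rewrite /A /Z /w exprD !rmorphM /=; ring.
  rewrite {1}(qpoch_inf_split p0 p1 w (k + k)) normcM ler_wpM2r ?normc_ge0 //.
  by apply: normc_qpoch_le => //; apply: ltW.
have AZ0 : 0 < normc (qpoch_inf (A * Z) p).
  by rewrite -(pmulr_rgt0 _ Q0); apply: lt_le_trans AZw.
have AZn : qpoch_inf (A * Z) p != 0.
  by apply/eqP => h; rewrite h normc0 ltxx in AZ0.
have AZV : (normc (qpoch_inf (A * Z) p))^-1 <= L.
  by rewrite /L ler_pdivlMr // ler_pdivrMl // mulrC.
(* Every difference in this numerator is O(p^k): the first gives Q C1, the other two give E each,
   and the division gives L. *)
have -> : qpoch_inf Z p / qpoch_inf (A * Z) p * qsum p A Z s - 1 =
  (qpoch_inf Z p * (qsum p A Z s - 1)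
   + ((qpoch_inf Z p - 1) - (qpoch_inf (A * Z) p - 1))) / qpoch_inf (A * Z) p.
  by field.
rewrite normcM normcV mulrAC ler_pM ?invr_ge0 ?normc_ge0 //.
apply: le_trans (normcD_le _ _) _; rewrite mulrDl -mulrA; apply: lerD.
  by rewrite normcM ler_pM ?normc_ge0.
by apply: le_trans (normcB_le _ _) _; rewrite mulrDl lerD.
Qed.

End Asymptotics.

(* Going from n to n.+1 exchanges the recurrence of r, which runs upwards in the
   index, against that of F, which runs downwards. *)
Lemma continuant_expansion (K : comNzRingType) (F r a b : nat -> K) :
  (forall k, F k = (1 + a k) * F k.+1 + b k.+1 * F k.+2) ->
  r 0%N = 1 -> r 1%N = 1 + a 0%N ->
  (forall k, r k.+2 = (1 + a k.+1) * r k.+1 + b k.+1 * r k) ->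
  forall n, F 0%N = r n.+1 * F n.+1 + b n.+1 * r n * F n.+2.
Proof.
move=> hF r0 r1 hr; elim=> [|n ->]; first by rewrite r0 r1 mulr1 -hF.
by rewrite (hF n.+1) hr; ring.
Qed.

(** * Uniform convergence at a geometric rate *)

Section Convergence.
Context {R : realType} {p al be : R}.
Hypotheses (p0 : 0 < p) (p1 : p < 1) (al1 : -1 < al) (be1 : -1 < be).

Let F k (x : R[i]) : R[i] := Phi p (al + k%:R) (be + k%:R) x.

Lemma Phi_recurrence k (x : R[i]) :
  F k x = (1 + (bA p al be k)%:C * x) * F k.+1 x
          + (bB p al be k.+1)%:C * x ^+ 2 * F k.+2 x.
Proof.
have k0 : 0 <= k%:R :> R by apply: ler0n.
have alk : -1 < al + k%:R by rewrite (lt_le_trans al1) // lerDl.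
have bek : -1 < be + k%:R by rewrite (lt_le_trans be1) // lerDl.
have := Phi_contiguous p0 p1 _ _ x alk bek.
rewrite -bA_shift -bB_shift /F.
have e1 (t : R) : t + k%:R + 1 = t + k.+1%:R by rewrite -(natr1 k); ring.
have e2 (t : R) : t + k%:R + 2 = t + k.+2%:R by rewrite -(natr1 k.+1) -(natr1 k); ring.
by rewrite 2!e1 2!e2.
Qed.

Lemma Phi_bres n (x : R[i]) :
  Phi p al be x = bres p al be n.+1 x * F n.+1 x
    + (bB p al be n.+1)%:C * x ^+ 2 * bres p al be n x * F n.+2 x.
Proof.
have -> : Phi p al be x = F 0%N x by rewrite /F !addr0.
exact: (continuant_expansion _ (fun k => F k x) (fun k => bres p al be k x)
  (fun k => (bA p al be k)%:C * x) (fun k => (bB p al be k)%:C * x ^+ 2)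
  (fun k => Phi_recurrence k x) (bres0 p al be x) (bres1 p al be x)
  (fun k => bresSS p al be k x) n).
Qed.

Lemma bres_bounded (M : R) : 0 <= M -> exists2 Y : R, 0 <= Y & forall n (x : R[i]),
  normc x <= M -> normc (bres p al be n x) <= Y.
Proof.
move=> M0; have [c c0 hc] := bA_bB_geometric p0 p1 al1 be1.
pose D := c * M + c * M ^+ 2.
have M20 : 0 <= c * M ^+ 2 by rewrite mulr_ge0 ?exprn_ge0.
have cM0 : 0 <= c * M by rewrite mulr_ge0.
(* 1 + c M bounds the initial values r_0 = 1 and r_1 = 1 + A_0 x. *)
exists ((1 + c * M) * qbound p D).
  by rewrite mulr_ge0 ?addr_ge0 // ltW // qbound_gt0.
move=> n x xM.
have nA k : normc ((bA p al be k)%:C * x) <= c * M * p ^+ k.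
  by rewrite normcM normcR mulrAC ler_pM ?normc_ge0 //; case: (hc k).
have nB k : normc ((bB p al be k.+1)%:C * x ^+ 2) <= c * M ^+ 2 * p ^+ k.
  rewrite normcM normcR normcX mulrAC ler_pM ?exprn_ge0 ?normc_ge0 //.
    by case: (hc k).
  by rewrite lerXn2r ?nnegrE ?normc_ge0.
apply: (three_term_bounded p (fun k => bres p al be k x)
  (fun k => (bA p al be k.+1)%:C * x) (fun k => (bB p al be k.+1)%:C * x ^+ 2)) => //.
- by move=> k; rewrite bresSS.
- move=> k; rewrite /D mulrDl; apply: lerD (nB k).
  apply: le_trans (nA _) _; rewrite ler_wpM2l //.
  by rewrite exprS ler_piMl ?exprn_ge0 // ltW.
- by rewrite bres0 normc1 lerDl.
- rewrite bres1; apply: le_trans (normcD_le _ _) _; rewrite normc1 lerD2l.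
  by have := nA 0%N; rewrite expr0 mulr1.
Qed.

Lemma bres_dist (M : R) : 0 <= M -> exists C : R, forall n (x : R[i]),
  normc x <= M -> normc (bres p al be n.+1 x - Phi p al be x) <= C * p ^+ n.
Proof.
move=> M0; have [c c0 hc] := bA_bB_geometric p0 p1 al1 be1.
have [Y Y0 hY] := bres_bounded _ M0.
have [C C0 hC] := Phi_dist1 p0 p1 al1 be1 _ M0.
(* The two summands bound r_{n+1} (F_{n+1} - 1) and B_{n+1} x^2 r_n F_{n+2}, where |F_{n+2}| <= 1 +
   C. *)
exists (Y * C + c * M ^+ 2 * Y * (1 + C)) => n x xM.
have pn0 k : 0 <= p ^+ k by rewrite exprn_ge0 // ltW.
have split_error (r r' b f f' : R[i]) :
  r - (r * f + b * r' * f') = - (r * (f - 1)) - b * r' * f' by ring.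
rewrite (Phi_bres n) split_error.
apply: le_trans (normcB_le _ _) _; rewrite normc_opp mulrDl; apply: lerD.
  rewrite normcM -mulrA ler_pM ?normc_ge0 ?hY //.
  apply: le_trans (hC _ _ xM) _; rewrite ler_wpM2l //.
  by rewrite exprS ler_piMl // ltW.
have F1 : normc (F n.+2 x) <= 1 + C.
  rewrite -(subrKC 1 (F n.+2 x)).
  apply: le_trans (normcD_le _ _) _; rewrite normc1 lerD2l.
  apply: le_trans (hC _ _ xM) _; rewrite ler_piMr //.
  exact: exprnp_le1.
have nB : normc (bB p al be n.+1)%:C <= c * p ^+ n by rewrite normcR; case: (hc n).
rewrite 3!normcM normcX.
have -> : c * M ^+ 2 * Y * (1 + C) * p ^+ n = c * p ^+ n * M ^+ 2 * Y * (1 + C) by ring.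
by rewrite !ler_pM ?mulr_ge0 ?exprn_ge0 ?normc_ge0 ?hY.
Qed.

End Convergence.

(* x^n b_n^{(al,be)}(1/x) -> Phi_{al,be}(x) uniformly on compact subsets of C,
   with p = q^{1/2}. *)
Theorem theorem5p1 (R : realType) (q al be : R)
  (hq0 : 0 < q) (hq1 : q < 1) (hal : -1 < al) (hbe : -1 < be) :
  forall K : set R[i], compact K ->
  forall eps : R, 0 < eps ->
  \forall n \near \oo, forall x : R[i], K x ->
    `| bres (q `^ (1 / 2)) al be n x - Phi (q `^ (1 / 2)) al be x | < eps%:C.
Proof.
move=> K cK eps eps0; have [M M0 KM] := compact_normc_bounded _ cK.
have p0 : 0 < q `^ (1 / 2) by rewrite powR_gt0.
have p1 : q `^ (1 / 2) < 1 by apply: powRp_lt1 => //; lra.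
have [C hC] := bres_dist p0 p1 hal hbe _ M0.
have [N hN] := exprn_lt_ex p0 p1 `|C| _ eps0.
(* The rate p^n concerns r_{n+1}, hence the shifted threshold; [C] carries no sign information,
   hence its absolute value. *)
exists N.+1 => // -[//|n] /= nN x Kx.
rewrite -[`|_|]/((normc _)%:C) ltcR.
apply: le_lt_trans (hC n x (KM x Kx)) _; apply: le_lt_trans hN.
apply: (@le_trans _ _ (`|C| * q `^ (1 / 2) ^+ n)).
  by rewrite ler_wpM2r ?exprn_ge0 ?(ltW p0) // ler_norm.
by rewrite ler_wpM2l // ler_wiXn2l // ltW.
Qed.
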